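(* Let $w$ be a positive even integer and $n$ a positive integer. 1. The Hecke operator $T_n^{\infty}$ on $\mathcal{Q}_{\mathcal{E},-w}$ is compatible with the Hecke operator $T_n^{\infty}$ on $\mathcal{E}_w$: for every $E\in\mathcal{E}_w$, $\Psi_w(T_n^{\infty}E)=T_n^{\infty}(\Psi_w(E))$. 2. For any $\widetilde f\in\mathcal{Q}_{\mathcal{E},-w}$ one has $T_n^{\infty}\widetilde f\in\mathcal{Q}_{\mathcal{E},-w}$.
   Context: A Dedekind symbol of weight $w$ is a function $E:\mathbb{Z}^{+}\times\mathbb{Z}\to\mathbb{C}$ with $E(h,k+h)=E(h,k)$ and $E(ch,ck)=c^{w}E(h,k)$ for all $c\in\mathbb{Z}^{+}$. $\mathcal{E}_w$ is the space of Dedekind symbols $E$ of weight $w$ for which $E(h,k)-E(k,-h)$ is (for $h,k\in\mathbb{Z}^{+}$) given by a homogeneous polynomial of degree $w$ in $h,k$ with complex coefficients. The map $\Psi_w$ sends $E\in\mathcal{E}_w$ to the function $\Psi_w(E):\mathbb{Q}\to\mathbb{C}$, $\Psi_w(E)(k/h)=h^{-w}E(h,k)$ ($h\in\mathbb{Z}^{+}$, $k\in\mathbb{Z}$), and $\mathcal{Q}_{\mathcal{E},-w}=\Psi_w(\mathcal{E}_w)$. The Hecke operator $T_n^{\infty}:\mathcal{E}_w\to\mathcal{E}_w$ (due to Fukuhara, who showed it preserves $\mathcal{E}_w$) is $$(T_n^{\infty}E)(h,k)=\sum_{ad=n,\ d>0}\ \sum_{b=0}^{d-1}E(dh,ak+bh).$$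 The Hecke operator $T_n^{\infty}$ on $\mathcal{Q}_{\mathcal{E},-w}$ is $$(T_n^{\infty}\widetilde f)(x)=\sum_{ad=n,\ d>0}d^{w}\sum_{b=0}^{d-1}\widetilde f\left(\frac{ax+b}{d}\right)\qquad(x\in\mathbb{Q}).$$ *)

(* Defs.v *)
From HB Require Import structures.
From mathcomp Require Import all_boot all_order all_algebra.
From mathcomp Require Import classical_sets reals.
From mathcomp Require Import complex mpoly.

Set Implicit Arguments.
Unset Strict Implicit.
Unset Printing Implicit Defensive.

Import Order.TTheory GRing.Theory Num.Theory.

Local Open Scope classical_set_scope.
Local Open Scope ring_scope.

(* The complex numbers are R[i] for R : realType. *)

Record posint := PosInt { posint_val :> nat; posint_gt0 : (0 < posint_val)%N }.

#[warnings="-projection-no-head-constant,-redundant-canonical-projection"]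
HB.instance Definition _ := [isSub for posint_val].
#[warnings="-redundant-canonical-projection"]
HB.instance Definition _ := [Choice of posint by <:].

Definition posint1 : posint := PosInt (ltn0Sn 0).

Lemma posint_mul_gt0 (c h : posint) : (0 < c * h)%N.
Proof. by rewrite muln_gt0 !posint_gt0. Qed.

Definition posint_mul (c h : posint) : posint := PosInt (posint_mul_gt0 c h).

(* 0 is sent to 1; only applied to divisors of a positive integer below. *)
Definition posint_of_nat (d : nat) : posint := insubd posint1 d.

Lemma posint_of_natK (d : nat) : (0 < d)%N -> posint_of_nat d = d :> nat.
Proof. by move=> d_gt0; rewrite -[LHS]/(\val (insubd posint1 d)) insubdK. Qed.

Lemma absz_denq_gt0 (x : rat) : (0 < `|denq x|)%N.
Proof. by rewrite absz_gt0 denq_neq0. Qed.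

Definition posint_denq (x : rat) : posint := PosInt (absz_denq_gt0 x).

Definition dedekind_symbol (R : realType) (w : nat)
    (E : posint -> int -> R[i]) : Prop :=
  (forall (h : posint) (k : int), E h (k + h%:Z) = E h k) /\
  (forall (c h : posint) (k : int),
     E (posint_mul c h) (c%:Z * k) = c%:R ^+ w * E h k).

(* [w.-homog] holds of the zero polynomial for every w. *)
Definition dedekind_space (R : realType) (w : nat) :
    set (posint -> int -> R[i]) :=
  [set E | dedekind_symbol w E /\
     exists2 P : {mpoly R[i][2]}, P \is w.-homog &
       forall h k : posint,
         E h k%:Z - E k (- h%:Z) = P.@[tnth [tuple h%:R; k%:R]]].

(* The value at x is computed from the reduced fraction of x; by Psi_frac the
   formula holds for every fraction k / h when E is a Dedekind symbol. *)
Definition Psi (R : realType) (w : nat) (E : posint -> int -> R[i]) :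
    rat -> R[i] :=
  fun x => (posint_denq x)%:R ^- w * E (posint_denq x) (numq x).

Lemma Psi_frac (R : realType) (w : nat) (E : posint -> int -> R[i])
    (h : posint) (k : int) :
  dedekind_symbol w E -> Psi w E (k%:Q / h%:Q) = h%:R ^- w * E h k.
Proof.
case=> _ E_hom; have h_neq0 : h%:Z != 0 by rewrite eqz_nat -lt0n posint_gt0.
rewrite /Psi; set x := k%:Q / h%:Q; set d := posint_denq x.
have dE : (d : nat)%:Z = denq x by rewrite -absz_denq.
have dn0 (p : posint) : p%:R ^+ w != 0 :> R[i].
  by rewrite expf_neq0 // pnatr_eq0 -lt0n posint_gt0.
have cross : d%:Z * k = h%:Z * numq x.
  apply: (@intr_inj rat); rewrite !intrM dE numqE mulrA.
  by rewrite [h%:Q * x]mulrC divfK ?intr_eq0 // mulrC.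
have mulE : posint_mul d h = posint_mul h d by apply: val_inj; rewrite /= mulnC.
have := E_hom d h k; rewrite mulE cross E_hom => eqE.
by apply: (mulfI (dn0 h)); rewrite mulrCA eqE mulrA mulVf // mul1r mulVKf.
Qed.

Definition Q_space (R : realType) (w : nat) : set (rat -> R[i]) :=
  Psi w @` dedekind_space (R := R) w.

Definition hecke_symbol (R : realType) (n : nat) (E : posint -> int -> R[i]) :
    posint -> int -> R[i] :=
  fun h k => \sum_(d <- divisors n) \sum_(b < d)
    E (posint_mul (posint_of_nat d) h) ((n %/ d)%N%:Z * k + b%:Z * h%:Z).

Definition hecke_Q (R : realType) (w n : nat) (f : rat -> R[i]) : rat -> R[i] :=
  fun x => \sum_(d <- divisors n) d%:R ^+ w *
    \sum_(b < d) f (((n %/ d)%N%:R * x + b%:R) / d%:R).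

(* Main.v *)
(* A Dedekind symbol E with polynomial reciprocity law F extends to a function
   G on all of Z^2, invariant under T (h, k) = (h, k + h) and under -1, with
   G(v) - G(S v) = F(v) everywhere, where S (h, k) = (k, - h).  This needs
   F(h, k) + F(- k, h) = 0, which follows from the three-term relation
   F(h, k) = F(h, h + k) + F(h + k, k): the left-hand side is a polynomial
   invariant under T and S, hence zero in positive weight.  As T and S generate
   SL_2(Z), G(v) - G(g v) is then a polynomial in v for every g in SL_2(Z).
   The Hecke operator sums G(M v) over the Hermite normal forms M of determinant
   n, and M S = g M' permutes these, so the reciprocity defect of T_n E is the
   sum of the polynomials G(M' v) - G(g M' v). *)
Require Import Defs.
From mathcomp Require Import all_boot all_order all_algebra.
From mathcomp Require Import boolp classical_sets reals.
From mathcomp Require Import complex mpoly.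
From mathcomp Require Import zify ring.

Set Implicit Arguments.
Unset Strict Implicit.
Unset Printing Implicit Defensive.

Import Order.TTheory GRing.Theory Num.Theory.

Local Open Scope classical_set_scope.
Local Open Scope ring_scope.

(** * Homogeneous polynomial functions on pairs of integers *)

Definition homog_polyfun (C : numFieldType) (w : nat) (F : int -> int -> C) :=
  exists2 P : {mpoly C[2]}, P \is w.-homog &
    forall h k : int, F h k = P.@[tnth [tuple h%:~R; k%:~R]].

Section HomogPolyfun.
Variables (C : numFieldType) (w : nat).
Implicit Types F G : int -> int -> C.

Lemma homog_polyfun0 : homog_polyfun w (fun _ _ => 0 : C).
Proof. by exists 0; [exact: dhomog0 | move=> h k; rewrite meval0]. Qed.

Lemma homog_polyfunD F G : homog_polyfun w F -> homog_polyfun w G ->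
  homog_polyfun w (fun h k => F h k + G h k).
Proof.
move=> [P hP PE] [Q hQ QE]; exists (P + Q); first exact: dhomogD.
by move=> h k; rewrite mevalD PE QE.
Qed.

Lemma homog_polyfun_sum (I : Type) (s : seq I) (F : I -> int -> int -> C) :
  (forall i, homog_polyfun w (F i)) ->
  homog_polyfun w (fun h k => \sum_(i <- s) F i h k).
Proof.
move=> hF; elim: s => [|i s [P hP PE]].
  by have [P hP PE] := homog_polyfun0; by exists P => // h k; rewrite big_nil -(PE h k).
have [Q hQ QE] := hF i; exists (Q + P); first exact: dhomogD.
by move=> h k; rewrite big_cons mevalD QE PE.
Qed.

Lemma homog_polyfun_lin F (p q r s : int) : homog_polyfun w F ->
  homog_polyfun w (fun h k => F (p * h + q * k) (r * h + s * k)).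
Proof.
move=> [P /dhomogP hP PE].
pose L (a b : int) : {mpoly C[2]} := a%:~R *: 'X_0 + b%:~R *: 'X_1.
have hL a b : L a b \is 1.-homog.
  by apply: dhomogD; apply: dhomogZ; rewrite dhomogX /= mdeg1.
exists (P \mPo [tuple L p q; L r s]); last first.
  move=> h k; rewrite PE comp_mpoly_meval; apply: meval_eq => i.
  have LE a b : (L a b).@[tnth [tuple h%:~R; k%:~R]] = (a * h + b * k)%:~R.
    by rewrite mevalD !mevalZ !mevalXU /= rmorphD !rmorphM.
  by case: i => [[|[|]]] //= lt_i2; rewrite !(tnth_nth 0) /= LE.
rewrite comp_mpolyE big_seq rpred_sum // => m m_supp.
apply: dhomogZ; rewrite -(hP m m_supp) /= mdegE !big_ord_recl !big_ord0 addn0 mulr1.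
by rewrite !(tnth_nth 0) /=; apply: dhomogM; rewrite -[X in X.-homog]mul1n;
   apply: dhomogMn.
Qed.

Lemma homog_polyfun_scale F (c h k : int) : homog_polyfun w F ->
  F (c * h) (c * k) = c%:~R ^+ w * F h k.
Proof.
move=> [P /dhomogP hP PE]; rewrite !PE !mevalE mulr_sumr; apply: eq_big_seq => m m_supp.
rewrite mulrCA; congr (_ * _); rewrite -(hP m m_supp) /= mdegE.
rewrite !big_ord_recl !big_ord0 addn0 !mulr1 !(tnth_nth 0) /= !intrM !exprMn exprD.
by rewrite mulrACA.
Qed.

(** Restriction to a line reduces identities in two variables to identities between polynomials in
    one variable, which can be checked along an arithmetic progression. *)
Lemma homog_polyfun_line F (h k u v : int) : homog_polyfun w F ->
  exists q : {poly C}, forall t : int, F (h + t * u) (k + t * v) = q.[t%:~R].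
Proof.
move=> [P _ PE].
exists (\sum_(m <- msupp P) P@_m *: ((h%:~R%:P + u%:~R *: 'X) ^+ m 0
                                     * (k%:~R%:P + v%:~R *: 'X) ^+ m 1)).
move=> t; rewrite PE mevalE horner_sum; apply: eq_bigr => m _.
rewrite hornerZ hornerM !horner_exp !hornerD !hornerZ !hornerC hornerX; congr (_ * _).
rewrite !big_ord_recl !big_ord0 !(tnth_nth 0) /= mulr1 !intrD !intrM.
by congr (_ ^+ _ * _ ^+ _); rewrite ?[t%:~R * _]mulrC //; congr (m _); exact: val_inj.
Qed.

End HomogPolyfun.

Lemma poly_eq_progression (C : numFieldType) (p q : {poly C}) (a b : int) :
  b != 0 -> (forall t : nat, p.[(a + t%:Z * b)%:~R] = q.[(a + t%:Z * b)%:~R]) ->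
  p = q.
Proof.
move=> b_neq0 eq_pq; apply/eqP; rewrite -subr_eq0; apply: contraT => nz.
pose rs := [seq (a + t%:Z * b)%:~R : C | t <- iota 0 (size (p - q))].
have := @max_poly_roots _ _ rs nz; rewrite size_map size_iota ltnn; apply.
  by apply/allP => _ /mapP[t _ ->]; rewrite rootE !hornerE eq_pq subrr.
rewrite map_inj_uniq ?iota_uniq // => t1 t2 /intr_inj /addrI /(mulIf b_neq0).
by case.
Qed.

Lemma homog_polyfun_eq (C : numFieldType) (w : nat) (F G : int -> int -> C) :
  homog_polyfun w F -> homog_polyfun w G ->
  (forall h k, 0 < h -> 0 < k -> F h k = G h k) -> forall h k, F h k = G h k.
Proof.
move=> hF hG eqFG h k.
have [p pE] := homog_polyfun_line h k 1 1 hF.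
have [q qE] := homog_polyfun_line h k 1 1 hG.
suff eq_pq : p = q by rewrite -[h]addr0 -[k]addr0 -(mul0r 1) pE qE eq_pq.
(* From [t = |h| + |k| + 1] on, the diagonal through [(h, k)] stays in the open positive
   quadrant. *)
apply: (@poly_eq_progression _ _ _ (`|h| + `|k| + 1) 1) => // t.
by rewrite -pE -qE; apply: eqFG; lia.
Qed.

(** Let [X] be the left-hand side. Invariance under T makes [X h] constant for each [h != 0], so
    [X h k = h^w * X 1 0]. Invariance under S at [(1, 2)] then gives [2^w * X 1 0 = X 1 0], and
    [w > 0] forces [X 1 0 = 0]. *)
Lemma period_polyfun_anti (C : numFieldType) (w : nat) (F : int -> int -> C) :
  (0 < w)%N -> ~~ odd w -> homog_polyfun w F ->
  (forall h k, 0 < h -> 0 < k -> F h k = F h (h + k) + F (h + k) k) ->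
  forall h k, F h k + F (- k) h = 0.
Proof.
move=> w_gt0 w_even hF rel_pos.
have rel h k : F h k = F h (h + k) + F (h + k) k.
  pose G h k := F (1 * h + 0 * k) (1 * h + 1 * k) + F (1 * h + 1 * k) (0 * h + 1 * k).
  have GE h' k' : G h' k' = F h' (h' + k') + F (h' + k') k'.
    by rewrite /G !mul1r !mul0r addr0 add0r.
  rewrite -GE; apply: (homog_polyfun_eq hF) => [|h' k' h_gt0 k_gt0].
    by apply: homog_polyfunD; apply: homog_polyfun_lin.
  by rewrite GE rel_pos.
have even_F h k : F (- h) (- k) = F h k.
  by rewrite -mulN1r -[- k]mulN1r (homog_polyfun_scale _ _ _ hF) rmorphN1
             -signr_odd (negPf w_even) mul1r.
pose X h k := F h k + F (- k) h.
have hX : homog_polyfun w X.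
  have [P hP PE] := homog_polyfunD hF (homog_polyfun_lin 0 (-1) 1 0 hF).
  by exists P => // h k; rewrite -PE /X; congr (_ + F _ _); ring.
have X_S h k : X h k = X (- k) h by rewrite /X even_F addrC.
have X_T h k : X h (h + k) = X h k.
  (* The three-term relation is used at [(h, k)] and at [(- (h + k), h)]. *)
  rewrite /X [F h k]rel [F (- (h + k)) h]rel -addrA; congr (_ + _).
  have -> : - (h + k) + h = - k by ring.
  by rewrite even_F.
have X_Tn h (t : nat) : X h (t%:Z * h) = X h 0.
  by elim: t => [|t IH]; rewrite ?mul0r // intS mulrDl mul1r X_T.
have X_const h k : h != 0 -> X h k = h%:~R ^+ w * X 1 0.
  move=> h_neq0; rewrite -(homog_polyfun_scale _ _ _ hX) mulr1 mulr0.
  have [q qE] := homog_polyfun_line h 0 0 1 hX.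
  have {}qE t : X h t = q.[t%:~R] by rewrite -qE mulr0 mulr1 addr0 add0r.
  suff qC : q = (X h 0)%:P by rewrite qE qC hornerC.
  apply: (@poly_eq_progression _ _ _ 0 h) => // t.
  by rewrite hornerC add0r -qE X_Tn.
have X10 : X 1 0 = 0.
  have := X_const 1 2%:Z isT; rewrite X_S X_const // rmorph1 expr1n mul1r => /eqP.
  rewrite -[X in _ == X]mul1r -subr_eq0 -mulrBl mulf_eq0 => /orP[|/eqP//].
  rewrite subr_eq0 rmorphN exprNn -signr_odd (negPf w_even) mul1r.
  by rewrite /= -pmulrn pexpr_eq1 ?ler0n // (pnatr_eq1 _ 2).
move=> h k; rewrite -/(X h k); have [h0|h_neq0] := eqVneq h 0; last first.
  by rewrite X_const // X10 mulr0.
(* S moves the axis [h = 0] to the other axis; at the origin homogeneity of positive weight gives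
   0. *)
rewrite h0 X_S; have [->|k_neq0] := eqVneq k 0.
  rewrite oppr0 -[in X in X _](mul0r 0) -[in X _](mul0r 0).
  by rewrite (homog_polyfun_scale 0 0 0 hX) expr0n eqn0Ngt w_gt0 mul0r.
by rewrite X_const ?oppr_eq0 // X10 mulr0.
Qed.

(** * Polynomial cocycles of SL_2(Z) *)

Lemma int_translation_invariant (T : Type) (G : int -> int -> T) :
  (forall h k, G h (k + h) = G h k) -> forall h k t, G h (k + t * h) = G h k.
Proof.
move=> G_T h k; elim=> [|t IH|t IH]; first by rewrite mul0r addr0.
  by rewrite intS mulrDl mul1r addrCA addrC G_T.
by rewrite -[LHS]G_T intS opprD mulrDl addrA mulN1r addrAC addrNK addrC -IH addrC.
Qed.

(* Euclid's algorithm on the first column (p, r) writes the matrix as a word in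
   T and S; left multiplication by T does not change G, and left multiplication
   by S changes it by a polynomial. *)
Lemma SL2_cocycle (C : numFieldType) (w : nat) (G F : int -> int -> C) :
  homog_polyfun w F ->
  (forall h k, G h (k + h) = G h k) -> (forall h k, G (- h) (- k) = G h k) ->
  (forall h k, G h k - G k (- h) = F h k) ->
  forall p q r s : int, p * s - q * r = 1 ->
  exists2 F', homog_polyfun w F' &
    forall h k, G h k - G (p * h + q * k) (r * h + s * k) = F' h k.
Proof.
move=> hF /int_translation_invariant G_T G_N G_S p.
have [m] := ubnP `|p|%N; elim: m p => // m IHm p; rewrite ltnS => le_pm q r s det1.
(* If [p = 0], the matrix is, up to sign, a power of T times S, so the defect is [F] itself. *)
have [p0|p_neq0] := eqVneq p 0.
  exists F => // h k; rewrite -G_S p0 mul0r add0r; congr (_ - _).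
  have [[-> ->]|[-> ->]] : (q = 1 /\ r = -1) \/ (q = -1 /\ r = 1).
    move: det1; rewrite p0 mul0r sub0r => qr1.
    have /eqP := congr1 absz qr1; rewrite abszN abszM muln_eq1 => /andP[/eqP q1 /eqP r1].
    have {}q1 : q = 1 \/ q = -1 by lia.
    by case: q1 qr1 => ->; lia.
    by rewrite mul1r mulN1r G_T.
  by rewrite !mulN1r mul1r -G_N opprK opprD -mulNr G_T.
have /= r_eq := divz_eq r p; have r'_lt := ltz_mod r p_neq0.
have r'_ge0 := modz_ge0 r p_neq0.
move: (r %/ p)%Z (r %% p)%Z r_eq r'_lt r'_ge0 => t r' r_eq r'_lt r'_ge0.
(* With [r = t * p + r'], the matrix equals T^t S N, where N has rows [(- r', - (s - t * q))] and
   [(p, q)]. N has determinant 1 and a smaller corner entry, so the induction hypothesis applies to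
   it. *)
have [F' hF' F'E] : exists2 F', homog_polyfun w F' & forall h k,
    G h k - G ((- r') * h + (- (s - t * q)) * k) (p * h + q * k) = F' h k.
  by apply: IHm; [lia | rewrite -det1 r_eq; ring].
exists (fun h k => F' h k + F ((- r') * h + (- (s - t * q)) * k) (p * h + q * k)).
  exact/homog_polyfunD/homog_polyfun_lin.
move=> h k; rewrite -F'E -G_S addrA subrK; congr (_ - _).
rewrite -[RHS](G_T _ _ t) r_eq; congr (G _ _); ring.
Qed.

(** * Hermite normal forms of determinant [n] *)

Definition hecke_index (n : nat) : seq (nat * nat) :=
  [seq (d, b) | d <- divisors n, b <- iota 0 d].

Lemma mem_hecke_index (n d b : nat) : (0 < n)%N ->
  ((d, b) \in hecke_index n) = (d %| n)%N && (b < d)%N.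
Proof.
move=> n_gt0; rewrite dvdn_divisors //; apply/allpairsPdep/andP => /=.
  by move=> [x [y [xn + [-> ->]]]]; rewrite mem_iota.
by move=> [dn bd]; exists d, b; rewrite mem_iota.
Qed.

Lemma hecke_index_uniq (n : nat) : uniq (hecke_index n).
Proof.
apply: allpairs_uniq_dep => [|d _|]; [exact: divisors_uniq | exact: iota_uniq |].
by move=> [d b] [d' b'] _ _ /= [-> ->].
Qed.

Lemma big_hecke_index (C : nmodType) (n : nat) (f : nat -> nat -> C) :
  \sum_(d <- divisors n) \sum_(b < d) f d b = \sum_(i <- hecke_index n) f i.1 i.2.
Proof.
rewrite big_allpairs_dep; apply: eq_bigr => d _.
by rewrite -(big_mkord xpredT (f d)) /index_iota subn0.
Qed.

(* With M_(d, b) = [[d, 0], [b, n / d]] acting on columns (h, k), this says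
   M_i S = g M_j for the matrix g = [[p, q], [r, s]] of determinant 1, where
   S (h, k) = (k, - h). *)
Definition hecke_coset (n : nat) (i j : nat * nat) : Prop :=
  exists p q r s : int,
    [/\ p * s - q * r = 1,
        p * j.1%:Z + q * j.2%:Z = 0, q * (n %/ j.1)%N%:Z = i.1%:Z,
        r * j.1%:Z + s * j.2%:Z = - (n %/ i.1)%N%:Z
      & s * (n %/ j.1)%N%:Z = i.2%:Z].

(** The second column of M_i S is [(d, b)], which must be [n / D] times [(q, s)]. Taking
    [n / D = gcd(d, b)] makes [(q, s)] primitive, and Bezout supplies the first column of the matrix
    of determinant 1. *)
Lemma hecke_coset_exists (n : nat) (i : nat * nat) : (0 < n)%N ->
  i \in hecke_index n -> exists2 j, j \in hecke_index n & hecke_coset n i j.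
Proof.
case: i => d b n_gt0; rewrite mem_hecke_index // => /andP[d_dvd_n lt_bd].
have d_gt0 : (0 < d)%N by apply: leq_ltn_trans lt_bd.
pose g := gcdn d b; have g_gt0 : (0 < g)%N by rewrite gcdn_gt0 d_gt0.
have [q' dE] : exists q', d = (q' * g)%N by apply/dvdnP/dvdn_gcdl.
have [s' bE] : exists s', b = (s' * g)%N by apply/dvdnP/dvdn_gcdr.
have [a nE] : exists a, n = (a * d)%N by apply/dvdnP.
have [u [v]] := Bezoutz s'%:Z q'%:Z.
have -> : gcdz s'%:Z q'%:Z = 1.
  rewrite /gcdz !absz_nat; congr Posz; apply/eqP.
  by rewrite -(eqn_pmul2r g_gt0) mul1n muln_gcdl -bE -dE gcdnC.
move=> uv1; set D := (a * q')%N.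
have a_gt0 : (0 < a)%N by move: n_gt0; rewrite nE muln_gt0 => /andP[].
have q'_gt0 : (0 < q')%N by move: d_gt0; rewrite dE muln_gt0 => /andP[].
have nDg : n = (D * g)%N by rewrite nE dE mulnA.
have D_gt0 : (0 < D)%N by rewrite muln_gt0 a_gt0.
have nD : (n %/ D)%N = g by rewrite nDg mulKn.
have nd : (n %/ d)%N = a by rewrite nE mulnK.
have D_neq0 : D%:Z != 0 by rewrite eqz_nat -lt0n.
(* Bezout coefficients may be shifted by multiples of [(q', s')]; dividing [- a * u] by [D] picks
   the shift that brings [B] into [[0, D)]. *)
have B_eq := divz_eq (- a%:Z * u) D%:Z; have B_ge0 := modz_ge0 (- a%:Z * u) D_neq0.
have B_lt := ltz_mod (- a%:Z * u) D_neq0.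
move: (_ %/ _)%Z (_ %% _)%Z B_eq B_ge0 B_lt => t [B|//] B_eq _ B_lt.
exists (D, B).
  by rewrite mem_hecke_index // nDg dvdn_mulr //=; move: B_lt; lia.
have DE : D%:Z = a%:Z * q'%:Z by [].
have {}B_eq : B%:Z = - a%:Z * (u + t * q'%:Z).
  by rewrite mulrDr B_eq DE; ring.
exists (u + t * q'%:Z), q'%:Z, (- v + t * s'%:Z), s'%:Z.
rewrite /= nD nd {1}dE {1}bE !PoszM B_eq; split=> //.
- by rewrite -uv1; ring.
- by ring.
- by rewrite -[RHS]mulr1 -uv1; ring.
Qed.

(** The two Hermite forms are left equivalent under SL_2(Z). The top rows of the two matrices are
    primitive and proportional, with positive [q1] and [q2], so they coincide; then [d1 = d2], and
    [b1], [b2] are congruent modulo [d1], hence equal. *)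
Lemma hecke_coset_inj (n : nat) (i1 i2 j : nat * nat) : (0 < n)%N ->
  i1 \in hecke_index n -> i2 \in hecke_index n -> j \in hecke_index n ->
  hecke_coset n i1 j -> hecke_coset n i2 j -> i1 = i2.
Proof.
case: i1 i2 j => [d1 b1] [d2 b2] [D B] n_gt0; rewrite !mem_hecke_index //.
move=> /andP[d1n lt_b1] /andP[d2n lt_b2] /andP[Dn lt_B].
move=> [p1 [q1 [r1 [s1 /= [det1 pq1 q1E _ s1E]]]]].
move=> [p2 [q2 [r2 [s2 /= [det2 pq2 q2E _ s2E]]]]].
have D_gt0 : (0 < D)%N := leq_ltn_trans (leq0n _) lt_B.
have D_neq0 : D%:Z != 0 by rewrite eqz_nat -lt0n.
have A_gt0 : (0 < n %/ D)%N by rewrite divn_gt0 // dvdn_leq.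
move: (n %/ D)%N A_gt0 q1E s1E q2E s2E => A A_gt0 q1E s1E q2E s2E.
have d1_gt0 : (0 < d1)%N := leq_ltn_trans (leq0n _) lt_b1.
have d2_gt0 : (0 < d2)%N := leq_ltn_trans (leq0n _) lt_b2.
have A_gt0z : 0 < A%:Z by [].
have q1_gt0 : 0 < q1 by rewrite -(pmulr_lgt0 _ A_gt0z) q1E.
have q2_gt0 : 0 < q2 by rewrite -(pmulr_lgt0 _ A_gt0z) q2E.
have pq : p1 * q2 = p2 * q1.
  apply: (mulIf D_neq0).
  have -> : p1 * q2 * D = q2 * (p1 * D + q1 * B) - q1 * q2 * B by ring.
  rewrite pq1; have -> : p2 * q1 * D = q1 * (p2 * D + q2 * B) - q1 * q2 * B by ring.
  by rewrite pq2 !mulr0.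
have q1q2 : q1 = q2 * (p1 * s2 - q1 * r2).
  by rewrite -[LHS]mulr1 -det2 mulrBr mulrA [q1 * p2]mulrC -pq; ring.
have q2q1 : q2 = q1 * (p2 * s1 - q2 * r1).
  by rewrite -[LHS]mulr1 -det1 mulrBr mulrA [q2 * p1]mulrC pq; ring.
have le_mul (x y m : int) : 0 < x -> 0 < y -> x = y * m -> y <= x.
  move=> x_gt0 y_gt0 xE; rewrite xE ler_peMr // ?(ltW y_gt0) //.
  by rewrite -gtz0_ge1 -(pmulr_rgt0 _ y_gt0) -xE.
have qq : q1 = q2.
  by apply/eqP; rewrite eq_le (le_mul _ _ _ _ _ q1q2) ?(le_mul _ _ _ _ _ q2q1).
subst q2; have pp : p1 = p2 by apply: (mulIf (lt0r_neq0 q1_gt0)).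
subst p2; have dd : d1 = d2 by apply/eqP; rewrite -eqz_nat -q1E -q2E.
subst d2.
(* Subtracting the determinants gives [p1 * (s1 - s2) = q1 * (r1 - r2)]; multiplying [s1 - s2] by
   the second determinant, which is 1, yields the witness. *)
have [m ss] : exists m, s1 - s2 = q1 * m.
  exists ((r1 - r2) * s2 - r2 * (s1 - s2)).
  rewrite -[LHS]mulr1 -det2.
  have -> : (s1 - s2) * (p1 * s2 - q1 * r2) =
    ((p1 * s1 - q1 * r1) - (p1 * s2 - q1 * r2)) * s2
    + q1 * ((r1 - r2) * s2 - r2 * (s1 - s2)) by ring.
  by rewrite det1 det2 subrr mul0r add0r.
have bb : b1%:Z - b2%:Z = d1%:Z * m.
  by rewrite -s1E -s2E -mulrBl ss -q1E mulrAC.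
congr (_, _).
have m0 : m = 0 by nia.
by move: bb; rewrite m0 mulr0; lia.
Qed.

(** Any choice of [j] for each [i] is an injective self-map of a finite list without repetition,
    hence a permutation of it. *)
Lemma hecke_coset_perm (n : nat) : (0 < n)%N ->
  exists2 f : nat * nat -> nat * nat,
    perm_eq (map f (hecke_index n)) (hecke_index n)
  & {in hecke_index n, forall i, hecke_coset n i (f i)}.
Proof.
move=> n_gt0.
have /choice[f f_rel] i : exists j, i \in hecke_index n ->
    j \in hecke_index n /\ hecke_coset n i j.
  case: (boolP (i \in hecke_index n)) => [i_in|_]; last by exists i.
  by have [j j_in ij] := hecke_coset_exists n_gt0 i_in; exists j.
exists f => [|i /f_rel[]//].
have f_sub : {subset map f (hecke_index n) <= hecke_index n}.
  by move=> _ /mapP[i /f_rel[fi_in _] ->].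
have f_uniq : uniq (map f (hecke_index n)).
  rewrite map_inj_in_uniq ?hecke_index_uniq // => i1 i2 i1_in i2_in eq_f.
  have [fi1 rel1] := f_rel _ i1_in; have [_ rel2] := f_rel _ i2_in.
  by apply: hecke_coset_inj rel1 _ => //; rewrite eq_f.
apply: uniq_perm => //; first exact: hecke_index_uniq.
by have [] := uniq_min_size f_uniq f_sub; rewrite ?size_map.
Qed.

(** * Extension of a Dedekind symbol to all pairs of integers *)

Lemma posint_of_nat_val (h : posint) : posint_of_nat h = h.
Proof. by apply: val_inj; rewrite /= posint_of_natK ?posint_gt0. Qed.

Lemma int_posint_ind (Q : int -> Prop) : Q 0 ->
  (forall h : posint, Q h%:Z) -> (forall h : posint, Q (- h%:Z)) -> forall h, Q h.
Proof.
move=> Q0 Qpos Qneg [[//|h]|h]; first exact: (Qpos (PosInt (ltn0Sn h))).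
by rewrite NegzE; apply: (Qneg (PosInt (ltn0Sn h))).
Qed.

(* The value at (0, 1) chosen in the proof is the one for which the reciprocity
   law holds on the coordinate axes too. *)
Lemma dedekind_space_extend (R : realType) (w : nat) (E : posint -> int -> R[i]) :
  (0 < w)%N -> ~~ odd w -> dedekind_space w E ->
  exists G : int -> int -> R[i],
    [/\ forall (h : posint) k, G h%:Z k = E h k,
        forall h k, G h (k + h) = G h k,
        forall h k, G (- h) (- k) = G h k &
        exists2 F, homog_polyfun w F & forall h k, G h k - G k (- h) = F h k].
Proof.
move=> w_gt0 w_even [[E_T E_hom] [P hP PE]].
pose F (h k : int) : R[i] := P.@[tnth [tuple h%:~R; k%:~R]].
have hF : homog_polyfun w F by exists P.
have E_S (h k : posint) : E h k%:Z - E k (- h%:Z) = F h k by rewrite PE.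
have F_anti : forall h k, F h k + F (- k) h = 0.
  apply: (period_polyfun_anti w_gt0 w_even hF).
  move=> [[//|h]|//] [[//|k]|//] _ _.
  pose h' := PosInt (ltn0Sn h); pose k' := PosInt (ltn0Sn k).
  have hk_gt0 : (0 < h' + k')%N by [].
  (* The three-term relation telescopes: by periodicity [E (h + k) (- h) = E (h + k) k], so the
     middle terms cancel. *)
  have := (E_S h' (PosInt hk_gt0), E_S (PosInt hk_gt0) k', E_S h' k').
  rewrite /= !PoszD => -[[<- <-] <-].
  have -> : E h' (h'%:Z + k'%:Z) = E h' k'%:Z by rewrite addrC E_T.
  have -> : E k' (- (h'%:Z + k'%:Z)) = E k' (- h'%:Z).
    by rewrite -(E_T k') opprD addrNK.
  have -> : E (PosInt hk_gt0) (- h'%:Z) = E (PosInt hk_gt0) k'%:Z.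
    by rewrite -(E_T (PosInt hk_gt0)) /= PoszD addKr.
  by rewrite addrA addrNK.
pose c := F 0 1 + E posint1 0.
pose G h k := if h == 0 then c * k%:~R ^+ w
              else E (posint_of_nat `|h|%N) (if 0 < h then k else - k).
have G0 k : G 0 k = c * k%:~R ^+ w by [].
have even_w (k : int) : (- k)%:~R ^+ w = k%:~R ^+ w :> R[i].
  by rewrite rmorphN /= exprNn -signr_odd (negPf w_even) mul1r.
have G_pos (h : posint) k : G h%:Z k = E h k.
  rewrite /G eqz_nat ltz_nat posint_gt0 absz_nat posint_of_nat_val.
  by rewrite eqn0Ngt posint_gt0.
have G_N h k : G (- h) (- k) = G h k.
  rewrite /G oppr_eq0 even_w abszN oppr_gt0 opprK; case: ifP => // h_neq0.
  by case: ltgtP h_neq0.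
have G_T h k : G h (k + h) = G h k.
  elim/int_posint_ind: h => [|h|h]; first by rewrite addr0.
    by rewrite !G_pos E_T.
  by rewrite -G_N -[RHS]G_N !opprD !opprK !G_pos E_T.
exists G; split=> //; exists F => //.
have F_N h k : F (- h) (- k) = F h k.
  rewrite -mulN1r -[- k]mulN1r (homog_polyfun_scale _ _ _ hF).
  by rewrite even_w rmorph1 expr1n mul1r.
have E0 (h : posint) : E h 0 = h%:R ^+ w * E posint1 0.
  by rewrite -E_hom mulr0; congr (E _ _); apply: val_inj; rewrite /= muln1.
have G_S0 k : G 0 k - G k 0 = F 0 k.
  have -> : G k 0 = k%:~R ^+ w * E posint1 0.
    elim/int_posint_ind: k => [|k|k].
    - by rewrite G0 expr0n eqn0Ngt w_gt0 mulr0 mul0r.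
    - by rewrite G_pos (E0 k) -pmulrn.
    - by rewrite -[G _ _]G_N opprK oppr0 G_pos (E0 k) even_w -pmulrn.
  have F0 : F 0 k = k%:~R ^+ w * F 0 1.
    by rewrite -(homog_polyfun_scale _ _ _ hF) mulr0 mulr1.
  by rewrite F0 G0 /c; ring.
(* For [k <= 0], [F_anti] deduces the law at [(h, k)] from the law at [(- k, h)], which lies in the
   positive quadrant or on the axis of [G_S0]. *)
have G_S (h : posint) k : G h%:Z k - G k (- h%:Z) = F h k.
  elim/int_posint_ind: k => [|k|k].
  - have := F_N h%:Z 0; rewrite oppr0 => F_N0.
    have /eqP := F_anti 0 h%:Z; rewrite F_N0 addrC addr_eq0 => /eqP ->.
    by rewrite -G_S0 opprB -[G 0 (- _)]G_N oppr0 opprK.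
  - by rewrite !G_pos E_S.
  - have /eqP := F_anti h%:Z (- k%:Z); rewrite opprK addr_eq0 => /eqP ->.
    by rewrite -E_S opprB G_N !G_pos.
move=> h; elim/int_posint_ind: h => [|h|h] k //.
by rewrite -[G (- _) k]G_N -[G k _]G_N -[F _ _]F_N !opprK G_S.
Qed.

(** * Hecke operators on Dedekind symbols and on functions of a rational *)

Lemma hecke_symbol_dedekind (R : realType) (w n : nat) (E : posint -> int -> R[i]) :
  (0 < n)%N -> dedekind_symbol w E -> dedekind_symbol w (hecke_symbol n E).
Proof.
move=> n_gt0 [E_T E_hom]; split=> [h k|c h k]; rewrite /hecke_symbol; last first.
  rewrite mulr_sumr; apply: eq_bigr => d _; rewrite mulr_sumr; apply: eq_bigr => b _.
  rewrite -E_hom; congr (E _ _); last by rewrite /= PoszM; ring.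
  by apply: val_inj; rewrite /= mulnCA.
rewrite big_seq [RHS]big_seq; apply: eq_bigr => d; rewrite -dvdn_divisors // => d_dvd_n.
have d_gt0 : (0 < d)%N := dvdn_gt0 n_gt0 d_dvd_n.
set d' := posint_of_nat d; set x := (n %/ d)%N%:Z * k.
(* Adding [h] to [k] shifts [b] by [n / d]. The induction treats this as unit shifts, with [x] held
   fixed; each one replaces the term [b = 0] by the equal term [b = d]. *)
rewrite mulrDr -/x; elim: (n %/ d)%N => [|a IH]; first by rewrite mul0r addr0.
rewrite -[RHS]IH {IH}.
pose g (b : nat) := E (posint_mul d' h) (x + a%:Z * h%:Z + b%:Z * h%:Z).
have g_d : g d = g 0%N.
  by rewrite /g mul0r addr0 -[RHS]E_T /= posint_of_natK // PoszM; congr (E _ _); ring.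
transitivity (\sum_(b < d) g b.+1).
  by apply: eq_bigr => b _; rewrite /g !intS; congr (E _ _); ring.
apply: (@addrI _ (g 0%N)).
transitivity (\sum_(b < d.+1) g b); first by rewrite big_ord_recl.
by rewrite big_ord_recr /= g_d addrC.
Qed.

Lemma hecke_symbol_space (R : realType) (w n : nat) (E : posint -> int -> R[i]) :
  (0 < w)%N -> ~~ odd w -> (0 < n)%N ->
  dedekind_space w E -> dedekind_space w (hecke_symbol n E).
Proof.
move=> w_gt0 w_even n_gt0 E_in.
split; first by apply: hecke_symbol_dedekind => //; case: E_in.
have [G [G_pos G_T G_N [F hF G_S]]] := dedekind_space_extend w_gt0 w_even E_in.
pose M (i : nat * nat) h k := G (i.1%:Z * h) ((n %/ i.1)%N%:Z * k + i.2%:Z * h).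
have HE (h : posint) k : hecke_symbol n E h k = \sum_(i <- hecke_index n) M i h%:Z k.
  rewrite -(big_hecke_index n (fun d b => M (d, b) h%:Z k)).
  rewrite /hecke_symbol big_seq [RHS]big_seq; apply: eq_bigr => d.
  rewrite -dvdn_divisors // => /(dvdn_gt0 n_gt0) d_gt0; apply: eq_bigr => b _.
  by rewrite -G_pos /M /= posint_of_natK // PoszM.
have [f f_perm f_coset] := hecke_coset_perm n_gt0.
have /choice[H H_poly] i : exists H, homog_polyfun w H /\
    (i \in hecke_index n -> forall h k, M (f i) h k - M i k (- h) = H h k).
  case: (boolP (i \in hecke_index n)) => [/f_coset|_]; last first.
    by exists (fun _ _ => 0); split=> //; exact: homog_polyfun0.
  move=> [p [q [r [s [det1 e1 e2 e3 e4]]]]].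
  have [K hK KE] := SL2_cocycle hF G_T G_N G_S det1.
  set j := f i in e1 e2 e3 e4 *.
  (* This is the cocycle of g evaluated at M_j v for v = [(h, k)], since g M_j v = M_i S v. *)
  exists (fun h k => K (j.1%:Z * h + 0 * k) (j.2%:Z * h + (n %/ j.1)%N%:Z * k)).
  split=> [|_ h k]; first exact: homog_polyfun_lin.
  rewrite -KE /M mul0r addr0 [j.2%:Z * h + _]addrC; congr (_ - G _ _).
    transitivity ((p * j.1%:Z + q * j.2%:Z) * h + q * (n %/ j.1)%N%:Z * k); last by ring.
    by rewrite e1 e2 mul0r add0r.
  transitivity ((r * j.1%:Z + s * j.2%:Z) * h + s * (n %/ j.1)%N%:Z * k); last by ring.
  by rewrite e3 e4 mulrN mulNr.
have [P hP PE] := homog_polyfun_sum (hecke_index n) (fun i => (H_poly i).1).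
(* Only the first of the two sums is reindexed along [f], which pairs [M (f i)] with [M i]. *)
exists P => // h k; rewrite !HE -(perm_big _ f_perm) big_map -sumrB /=.
rewrite -[RHS](PE h k) big_seq [RHS]big_seq; apply: eq_bigr => i i_in.
exact: (H_poly i).2.
Qed.

(** The sums agree term by term. The fraction with denominator [d * h] need not be reduced, hence
    the appeal to [Psi_frac]; the weight [d^w] cancels the extra [d^(-w)]. *)
Lemma Psi_hecke (R : realType) (w n : nat) (E : posint -> int -> R[i]) :
  (0 < n)%N -> dedekind_symbol w E ->
  Psi w (hecke_symbol n E) = hecke_Q w n (Psi w E).
Proof.
move=> n_gt0 E_sym; apply/funext => x.
rewrite /hecke_Q /Psi -/(Psi w E) /hecke_symbol mulr_sumr.
rewrite big_seq [RHS]big_seq; apply: eq_bigr => d.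
rewrite -dvdn_divisors // => /(dvdn_gt0 n_gt0) d_gt0.
rewrite !mulr_sumr; apply: eq_bigr => b _.
set h := posint_denq x; set a := (n %/ d)%N.
have hE : h%:Z = denq x by rewrite -absz_denq.
have h_neq0 : h%:Q != 0 by rewrite hE intr_eq0 denq_neq0.
have d_neq0 : d%:R != 0 :> rat by rewrite pnatr_eq0 -lt0n.
pose dh := posint_mul (posint_of_nat d) h.
have -> : (a%:R * x + b%:R) / d%:R = (a%:Z * numq x + b%:Z * h%:Z)%:Q / dh%:Q.
  rewrite -{1}[x]divq_num_den -hE /dh /= posint_of_natK //.
  rewrite PoszM rmorphD !rmorphM /= -!pmulrn; field.
  by rewrite h_neq0 d_neq0.
rewrite -/(Psi w E _) Psi_frac // /dh /= posint_of_natK // natrM exprMn invfM !mulrA.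
rewrite mulfV ?mul1r //.
by rewrite expf_neq0 // pnatr_eq0 -lt0n.
Qed.

Theorem proposition4p1 (R : realType) (w n : nat)
    (w_gt0 : (0 < w)%N) (w_even : ~~ odd w) (n_gt0 : (0 < n)%N) :
  (forall E : posint -> int -> R[i], dedekind_space w E ->
     Psi w (hecke_symbol n E) = hecke_Q w n (Psi w E)) /\
  (forall f : rat -> R[i], Q_space w f -> Q_space w (hecke_Q w n f)).
Proof.
have Psi_T E : dedekind_space w E ->
    Psi w (hecke_symbol n E) = hecke_Q (R := R) w n (Psi w E).
  by case=> E_sym _; apply: Psi_hecke.
split=> [//|_ [E E_in <-]]; exists (hecke_symbol n E); last exact: Psi_T.
exact: hecke_symbol_space.
Qed.
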